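(* Assume that $Z^TQZ$ is indefinite. Let $\alpha_e=-\lambda_{\min}(Q)$, $\alpha_g=-\lambda_{\min}(Q,I_n+A^TA)$ and $\alpha_z=-\lambda_{\min}(Z^TQZ)$. Denote by $\mu_{\mathrm{EIG}}$, $\mu_{\mathrm{GEIG}}$, $\mu_{\mathrm{EIGZ}}$, $\mu_{\mathrm{SDP\_d}}$, $\mu_{\mathrm{SDP\_dax}}$, $\mu_{\mathrm{SDP\_da}}$ the optimal objective function values of the problems (EIG), (GEIG), (EIGZ), (SDP_d), (SDP_dax), (SDP_da) defined in the context, respectively. Then the following hold: (i) $\mu_{\mathrm{SDP\_d}}\ge\mu_{\mathrm{EIG}}$. (ii) $\mu_{\mathrm{SDP\_dax}}=\mu_{\mathrm{SDP\_da}}\ge\mu_{\mathrm{EIGZ}}\ge\mu_{\mathrm{GEIG}}\ge\mu_{\mathrm{EIG}}$.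
   Context: $Q\in\mathbb R^{n\times n}$ is symmetric, $q\in\mathbb R^n$, and $\mathcal X=\{x\in\mathbb R^n: Ax=b,\ Cx\le d,\ l\le x\le u\}$ with $A\in\mathbb R^{m\times n}$, $b\in\mathbb R^m$, $C\in\mathbb R^{p\times n}$, $d\in\mathbb R^p$, and finite bounds $-\infty<l_i<u_i<\infty$ for all $i$. $Z$ is a matrix whose columns form an orthonormal basis of the nullspace of $A$. $\mathbb S^n$ is the set of real symmetric $n\times n$ matrices, $\langle M,P\rangle=\sum_{i,j}M_{ij}P_{ij}$, $M\succcurlyeq0$ means positive semidefinite, $I_n$ is the identity, $\lambda_{\min}(M)$ is the smallest eigenvalue of $M\in\mathbb S^n$, and for $M,N\in\mathbb S^n$ with $N$ positive definite, $\lambda_{\min}(M,N)=\min_{x\ne0}\frac{x^TMx}{x^TNx}$ is the smallest generalized eigenvalue of $Mv=\lambda Nv$. The problems are: (EIG): $\min_{x\in\mathcal X}\ x^T(Q+\alpha_eI_n)x+(q-\alpha_e(l+u))^Tx+\alpha_e\,l^Tu$. (GEIG): $\min_{x\in\mathcal X}\ x^T(Q+\alpha_g(I_n+A^TA))x+(q-\alpha_g(l+u+2A^Tb))^Tx+\alpha_g(l^Tu+b^Tb)$. (EIGZ): $\min_{x\in\mathcal X}\ x^T(Q+\alpha_zI_n)x+(q-\alpha_z(l+u))^Tx+\alpha_z\,l^Tu$. (SDP_d): $\min_{x\in\mathcal X,\,X\in\mathbb S^n}\ \langle Q,X\rangle+q^Tx$ subject to $X-xx^T\succcurlyeq0$ and,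 for $i=1,\dots,n$, $X_{ii}\ge2l_ix_i-l_i^2$, $X_{ii}\ge2u_ix_i-u_i^2$, $X_{ii}\le u_ix_i+l_ix_i-u_il_i$. (SDP_dax): the same problem as (SDP_d) with the additional constraints $\sum_{j=1}^nA_{kj}X_{ij}=b_kx_i$ for $k=1,\dots,m$, $i=1,\dots,n$. (SDP_da): the same problem as (SDP_d) with the additional constraint $\langle A^TA,X\rangle-2(A^Tb)^Tx+b^Tb=0$. *)

(* Defs.v *)
From HB Require Import structures.
From mathcomp Require Export all_boot all_order all_algebra.
From mathcomp Require Export boolp classical_sets reals ereal.

Set Implicit Arguments.
Unset Strict Implicit.
Unset Printing Implicit Defensive.

Export Order.TTheory GRing.Theory Num.Theory.

#[global] Open Scope classical_set_scope.
#[global] Open Scope ring_scope.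

Section LinearAlgebra.
Variable R : realType.

Definition dot n (x y : 'cV[R]_n) : R := (x^T *m y) 0 0.

Definition quad n (M : 'M[R]_n) (x : 'cV[R]_n) : R := (x^T *m M *m x) 0 0.

Definition frob n (M P : 'M[R]_n) : R := \sum_i \sum_j M i j * P i j.

(* Only applied to symmetric matrices; symmetry is always stated separately. *)
Definition psd n (M : 'M[R]_n) : Prop := forall v : 'cV[R]_n, 0 <= quad M v.

Definition indefinite n (M : 'M[R]_n) : Prop := ~ psd M /\ ~ psd (- M).

(* For symmetric M and n > 0 the set of eigenvalues is finite and nonempty, so
   this infimum is a minimum. [eigenvalue] refers to row eigenvectors, which
   makes no difference for the set of eigenvalues. *)
Definition lambda_min n (M : 'M[R]_n) : R := inf [set a : R | eigenvalue M a].

(* For symmetric M, positive definite N and n > 0 the Rayleigh quotient attains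
   its infimum, so this is a minimum. *)
Definition gen_lambda_min n (M N : 'M[R]_n) : R :=
  inf [set quad M x / quad N x | x in [set x : 'cV[R]_n | x != 0]].

Definition orthonormal_nullspace_basis m n k
    (A : 'M[R]_(m, n)) (Z : 'M[R]_(n, k)) : Prop :=
  Z^T *m Z = 1%:M /\
  (forall x : 'cV[R]_n, A *m x = 0 <-> exists y : 'cV[R]_k, x = Z *m y).

End LinearAlgebra.

(* Optimal value of  min f(z) s.t. z \in F;  it is +oo when F is empty. *)
Definition optval (R : realType) (T : Type) (F : set T) (f : T -> R) : \bar R :=
  ereal_inf [set (f z)%:E | z in F].

Section Problems.
Variables (R : realType) (n m p : nat).
Variables (Q : 'M[R]_n) (q : 'cV[R]_n).
Variables (A : 'M[R]_(m, n)) (b : 'cV[R]_m).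
Variables (C : 'M[R]_(p, n)) (d : 'cV[R]_p).
Variables (l u : 'cV[R]_n).

Definition feasX : set 'cV[R]_n :=
  [set x | [/\ A *m x = b,
               forall j, (C *m x) j 0 <= d j 0
             & forall i, l i 0 <= x i 0 <= u i 0]].

(* (EIG) is [mu_eig] at alpha_e and (EIGZ) is [mu_eig] at alpha_z. *)
Definition mu_eig (alpha : R) : \bar R :=
  optval feasX (fun x =>
    quad (Q + alpha *: 1%:M) x + dot (q - alpha *: (l + u)) x
    + alpha * dot l u).

Definition mu_geig (alpha : R) : \bar R :=
  optval feasX (fun x =>
    quad (Q + alpha *: (1%:M + A^T *m A)) x
    + dot (q - alpha *: (l + u + 2 *: (A^T *m b))) x
    + alpha * (dot l u + dot b b)).

Definition sdp_obj (z : 'cV[R]_n * 'M[R]_n) : R := frob Q z.2 + dot q z.1.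

Definition feas_d : set ('cV[R]_n * 'M[R]_n) :=
  [set z | let: (x, X) := z in
    [/\ feasX x, X^T = X, psd (X - x *m x^T)
      & forall i,
        [/\ X i i >= 2 * l i 0 * x i 0 - l i 0 ^+ 2,
            X i i >= 2 * u i 0 * x i 0 - u i 0 ^+ 2
          & X i i <= u i 0 * x i 0 + l i 0 * x i 0 - u i 0 * l i 0]]].

Definition feas_dax : set ('cV[R]_n * 'M[R]_n) :=
  [set z | let: (x, X) := z in
    feas_d (x, X) /\
    forall (k : 'I_m) (i : 'I_n), \sum_j A k j * X i j = b k 0 * x i 0].

Definition feas_da : set ('cV[R]_n * 'M[R]_n) :=
  [set z | let: (x, X) := z in
    feas_d (x, X) /\
    frob (A^T *m A) X - 2 * dot (A^T *m b) x + dot b b = 0].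

Definition mu_sdp_d : \bar R := optval feas_d sdp_obj.
Definition mu_sdp_dax : \bar R := optval feas_dax sdp_obj.
Definition mu_sdp_da : \bar R := optval feas_da sdp_obj.

End Problems.

(* Main.v *)
Require Import Defs.
From mathcomp Require Import ring lra.

(** On the feasible set [A x = b], hence the objectives of (EIG), (EIGZ) and
    (GEIG) have one common form ([mu_eigE], [mu_geigE]):
    [x^T Q x + q^T x + alpha * (x - l)^T (x - u)], with three values of
    [alpha].  The last scalar product is nonpositive on the box, so the optimal
    value decreases when [alpha] grows, and the last two inequalities of (ii)
    reduce to [alpha_z <= alpha_g <= alpha_e].  Each [alpha] is the least number
    that makes a shifted form semidefinite: [Q + alpha_g (I + A^T A)] restricts
    to [Z^T Q Z + alpha_g I] on the nullspace of [A], and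
    [Q + alpha_e I >= 0] implies [Q + alpha_e (I + A^T A) >= 0].  Indefiniteness
    provides [alpha_e, alpha_z >= 0] and a nonzero nullspace.

    For the semidefinite programs, let [Y = X - x x^T >= 0].  The upper bounds
    on the diagonal of [X] say in sum that
    [tr Y <= - (x - l)^T (x - u)].  So for [alpha >= 0], the program's objective
    at [(x, X)] is at least the convexified objective at [x] as soon as
    [<Q + alpha I, Y> >= 0] ([convexified_le_sdp_obj]).  With [alpha_e] this
    holds because the scalar product of two semidefinite matrices is nonnegative
    ([frob_psd_ge0]), which proves (i).  Each of the two families of additional
    constraints means [A Y = 0] ([dax_ker], [da_ker]); therefore the two
    programs agree, and [Y = Z (Z^T Y Z) Z^T], so that the scalar product is
    [<Z^T Q Z + alpha I, Z^T Y Z>], which is nonnegative already for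
    [alpha_z].

    The link with eigenvalues is that the smallest eigenvalue of a symmetric
    matrix is the infimum of its Rayleigh quotients ([lambda_minE]). *)

Set Implicit Arguments.
Unset Strict Implicit.
Unset Printing Implicit Defensive.

(** * Scalar products, quadratic forms and the matrix scalar product *)

Section Forms.
Variable R : realType.
Implicit Types (n m : nat) (a c : R).

Lemma dotE n (x y : 'cV[R]_n) : dot x y = \sum_i x i 0 * y i 0.
Proof. by rewrite /dot mxE; apply: eq_bigr => i _; rewrite mxE. Qed.

Lemma dotC n (x y : 'cV[R]_n) : dot x y = dot y x.
Proof. by rewrite !dotE; apply: eq_bigr => i _; rewrite mulrC. Qed.

Lemma dotx0 n (x : 'cV[R]_n) : dot x 0 = 0.
Proof. by rewrite /dot mulmx0 mxE. Qed.

Lemma dotDr n (x y z : 'cV[R]_n) : dot x (y + z) = dot x y + dot x z.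
Proof. by rewrite /dot mulmxDr mxE. Qed.

Lemma dotDl n (x y z : 'cV[R]_n) : dot (y + z) x = dot y x + dot z x.
Proof. by rewrite dotC dotDr !(dotC x). Qed.

Lemma dotZr n a (x y : 'cV[R]_n) : dot x (a *: y) = a * dot x y.
Proof. by rewrite /dot -scalemxAr mxE. Qed.

Lemma dotZl n a (x y : 'cV[R]_n) : dot (a *: x) y = a * dot x y.
Proof. by rewrite dotC dotZr dotC. Qed.

Lemma dotNr n (x y : 'cV[R]_n) : dot x (- y) = - dot x y.
Proof. by rewrite -scaleN1r dotZr mulN1r. Qed.

Lemma dotNl n (x y : 'cV[R]_n) : dot (- x) y = - dot x y.
Proof. by rewrite dotC dotNr dotC. Qed.

Lemma dot_mulmx n m (B : 'M[R]_(m, n)) (x : 'cV[R]_m) (y : 'cV[R]_n) :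
  dot x (B *m y) = dot (B^T *m x) y.
Proof. by rewrite /dot trmx_mul trmxK mulmxA. Qed.

Lemma dot_ge0 n (x : 'cV[R]_n) : 0 <= dot x x.
Proof. by rewrite dotE sumr_ge0 // => i _; rewrite -expr2 sqr_ge0. Qed.

Lemma dot_eq0 n (x : 'cV[R]_n) : (dot x x == 0) = (x == 0).
Proof.
apply/idP/eqP => [|->]; last by rewrite dotx0.
rewrite dotE psumr_eq0 => [/allP x0|i _]; last by rewrite -expr2 sqr_ge0.
apply/colP => i; rewrite mxE; apply/eqP.
by have := x0 i (mem_index_enum i); rewrite mulf_eq0 orbb.
Qed.

Lemma dot_gt0 n (x : 'cV[R]_n) : (0 < dot x x) = (x != 0).
Proof. by rewrite lt_def dot_ge0 andbT dot_eq0. Qed.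

Lemma quadE n (M : 'M[R]_n) x : quad M x = dot x (M *m x).
Proof. by rewrite /quad /dot mulmxA. Qed.

Lemma quadD n (M N : 'M[R]_n) x : quad (M + N) x = quad M x + quad N x.
Proof. by rewrite !quadE mulmxDl dotDr. Qed.

Lemma quadZ n a (M : 'M[R]_n) x : quad (a *: M) x = a * quad M x.
Proof. by rewrite !quadE -scalemxAl dotZr. Qed.

Lemma quadN n (M : 'M[R]_n) x : quad (- M) x = - quad M x.
Proof. by rewrite -scaleN1r quadZ mulN1r. Qed.

Lemma quad0 n (M : 'M[R]_n) : quad M 0 = 0.
Proof. by rewrite /quad mulmx0 mxE. Qed.

Lemma quad_id n (x : 'cV[R]_n) : quad 1%:M x = dot x x.
Proof. by rewrite quadE mul1mx. Qed.

Lemma quad_congr n m (M : 'M[R]_n) (B : 'M[R]_(n, m)) y :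
  quad M (B *m y) = quad (B^T *m M *m B) y.
Proof. by rewrite /quad trmx_mul !mulmxA. Qed.

Lemma quad_gram n m (A : 'M[R]_(m, n)) x :
  quad (A^T *m A) x = dot (A *m x) (A *m x).
Proof. by rewrite quadE -mulmxA dot_mulmx trmxK. Qed.

Lemma quad_outer n (x y : 'cV[R]_n) : quad (y *m y^T) x = dot x y ^+ 2.
Proof.
rewrite /quad mulmxA -mulmxA [LHS]mxE big_ord1 expr2; congr (_ * _).
by rewrite -[RHS]dotC.
Qed.

Lemma quad_comb n (M : 'M[R]_n) a c x y : M^T = M ->
  quad M (a *: x + c *: y) =
  a ^+ 2 * quad M x + 2 * (a * c) * dot x (M *m y) + c ^+ 2 * quad M y.
Proof.
move=> Msym; rewrite !quadE mulmxDr -!scalemxAr !dotDl !dotDr !dotZl !dotZr.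
by rewrite (dot_mulmx _ y x) Msym (dotC (M *m y)); ring.
Qed.

Lemma quad_delta n (M : 'M[R]_n) i : quad M (delta_mx i 0) = M i i.
Proof. by rewrite /quad trmx_delta -rowE -colE !mxE. Qed.

Lemma frob_tr n (M P : 'M[R]_n) : frob M P = \tr (M *m P^T).
Proof.
by apply: eq_bigr => i _; rewrite mxE; apply: eq_bigr => j _; rewrite mxE.
Qed.

Lemma frobDl n (M N P : 'M[R]_n) : frob (M + N) P = frob M P + frob N P.
Proof. by rewrite !frob_tr mulmxDl mxtraceD. Qed.

Lemma frobDr n (M N P : 'M[R]_n) : frob P (M + N) = frob P M + frob P N.
Proof. by rewrite !frob_tr linearD mulmxDr mxtraceD. Qed.

Lemma frobZl n a (M P : 'M[R]_n) : frob (a *: M) P = a * frob M P.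
Proof. by rewrite !frob_tr -scalemxAl mxtraceZ. Qed.

Lemma frobZr n a (M P : 'M[R]_n) : frob M (a *: P) = a * frob M P.
Proof. by rewrite !frob_tr linearZ -scalemxAr mxtraceZ. Qed.

Lemma frobNr n (M P : 'M[R]_n) : frob M (- P) = - frob M P.
Proof. by rewrite -scaleN1r frobZr mulN1r. Qed.

Lemma frob_id n (P : 'M[R]_n) : frob 1%:M P = \tr P.
Proof. by rewrite frob_tr mul1mx mxtrace_tr. Qed.

Lemma outer_sym n (y : 'cV[R]_n) : (y *m y^T)^T = y *m y^T.
Proof. by rewrite trmx_mul trmxK. Qed.

Lemma frob_outer n (M : 'M[R]_n) y : frob M (y *m y^T) = quad M y.
Proof.
by rewrite frob_tr outer_sym mulmxA mxtrace_mulC /mxtrace big_ord1 quadE.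
Qed.

Lemma frob_congr n m (M : 'M[R]_n) (B : 'M[R]_(n, m)) P :
  frob M (B *m P *m B^T) = frob (B^T *m M *m B) P.
Proof.
have BPBt : (B *m P *m B^T)^T = B *m P^T *m B^T.
  by rewrite !trmx_mul trmxK !mulmxA.
by rewrite !frob_tr BPBt mulmxA mxtrace_mulC !mulmxA.
Qed.

(** * Positive semidefinite matrices *)

Lemma psd_congr n m (M : 'M[R]_n) (B : 'M[R]_(n, m)) :
  psd M -> psd (B^T *m M *m B).
Proof. by move=> M0 y; rewrite -quad_congr. Qed.

(** Cauchy-Schwarz: the form is nonnegative at all combinations [s x + t y].
    The usual choice needs [quad M y > 0]; as a semidefinite form may vanish at
    nonzero vectors, the roles of [x] and [y] are exchanged when it fails, and
    if both values are zero then [x - e y] forces [e = 0]. *)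
Lemma psd_cauchy_schwarz n (M : 'M[R]_n) x y : M^T = M -> psd M ->
  dot x (M *m y) ^+ 2 <= quad M x * quad M y.
Proof.
move=> Msym M0; set a := quad M x; set c := quad M y; set e := dot _ _.
have a0 : 0 <= a := M0 x; have c0 : 0 <= c := M0 y.
have comb s t : 0 <= s ^+ 2 * a + 2 * (s * t) * e + t ^+ 2 * c.
  by rewrite -quad_comb.
rewrite -subr_ge0; have [c_eq0|cn0] := eqVneq c 0; last first.
  have c1 : 0 < c by rewrite lt_def cn0.
  rewrite -(pmulr_rge0 _ c1).
  (* The right-hand side is the value of the form at [c x - e y]. *)
  suff -> : c * (a * c - e ^+ 2) =
            c ^+ 2 * a + 2 * (c * - e) * e + (- e) ^+ 2 * c by [].
  by ring.
have [a_eq0|an0] := eqVneq a 0.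
  by have := comb 1 (- e); rewrite a_eq0 c_eq0; nra.
have a1 : 0 < a by rewrite lt_def an0.
rewrite -(pmulr_rge0 _ a1).
suff -> : a * (a * c - e ^+ 2) =
          (- e) ^+ 2 * a + 2 * (- e * a) * e + a ^+ 2 * c by [].
by ring.
Qed.

Lemma psd_ker n (M : 'M[R]_n) x : M^T = M -> psd M -> quad M x = 0 ->
  M *m x = 0.
Proof.
move=> Msym M0 x0; apply/eqP; rewrite -dot_eq0 -sqrf_eq0.
have := psd_cauchy_schwarz (M *m x) x Msym M0; rewrite x0 mulr0 => le0.
by apply/eqP/le_anti; rewrite le0 sqr_ge0.
Qed.

Lemma psd_diag0 n (Y : 'M[R]_n) i j : Y^T = Y -> psd Y -> Y i i = 0 ->
  Y i j = 0.
Proof.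
move=> Ysym Y0 Yi; have /colP/(_ j) : Y *m (delta_mx i 0 : 'cV_n) = 0.
  by apply: psd_ker; rewrite // quad_delta.
by rewrite -colE !mxE -{1}Ysym mxE.
Qed.

(** Subtracting the rank one matrix [(Y v) (Y v)^T / quad Y v] is the Schur
    complement step; that the remainder stays semidefinite is
    Cauchy-Schwarz.  When [quad Y v = 0] nothing is subtracted, as the inverse
    of zero is zero. *)
Lemma psd_schur n (Y : 'M[R]_n) v : Y^T = Y -> psd Y ->
  psd (Y - (quad Y v)^-1 *: ((Y *m v) *m (Y *m v)^T)).
Proof.
move=> Ysym Y0 x; rewrite quadD quadN quadZ quad_outer subr_ge0.
have := Y0 v; rewrite le_eqVlt => /orP[/eqP <-|v0].
  by rewrite invr0 mul0r Y0.
by rewrite mulrC ler_pdivrMr // psd_cauchy_schwarz.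
Qed.

(** Induction on the number of nonzero diagonal entries of [Y]: a Schur
    complement step at a basis vector clears one of them and keeps those
    that vanish, and the rank one matrix [w w^T] that it removes contributes
    a nonnegative multiple of [quad M w].  Once the diagonal is zero, so
    is [Y]. *)
Lemma frob_psd_ge0 n (M Y : 'M[R]_n) : psd M -> Y^T = Y -> psd Y ->
  0 <= frob M Y.
Proof.
move=> M0; have [N] := ubnP #|[pred i | Y i i != 0]|.
elim: N Y => // N IH Y; rewrite ltnS => leN Ysym Y0.
have [/forallP diag0|] := boolP [forall i, Y i i == 0]; last first.
  rewrite negb_forall => /existsP[i Yi].
  set v : 'cV[R]_n := delta_mx i 0.
  set w := Y *m v; set Y' := Y - (quad Y v)^-1 *: (w *m w^T).
  have Y'0 : psd Y' by exact: psd_schur.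
  have -> : Y = Y' + (quad Y v)^-1 *: (w *m w^T) by rewrite subrK.
  rewrite frobDr frobZr frob_outer addr_ge0 //; last first.
    by rewrite mulr_ge0 ?invr_ge0 ?Y0 ?M0.
  have Y'E j : Y' j j = Y j j - (Y i i)^-1 * Y j i ^+ 2.
    rewrite !mxE big_ord1 /w -colE !mxE /v quad_delta -expr2; ring.
  apply: IH => //; last first.
    by rewrite /Y' linearB linearZ /= outer_sym Ysym.
  apply: leq_trans leN; apply: proper_card; apply/properP; split.
    apply/fintype.subsetP => j; rewrite !inE; apply: contraNN => /eqP Yj.
    by rewrite Y'E Yj (psd_diag0 _ Ysym Y0 Yj) expr0n mulr0 subrr.
  by exists i; rewrite !inE // Y'E expr2 mulKf ?subrr ?eqxx.
have -> : Y = 0.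
  by apply/matrixP => i j; rewrite mxE; exact/psd_diag0/eqP/diag0.
by rewrite frob_tr trmx0 mulmx0 mxtrace0.
Qed.

(** * Smallest eigenvalues as infima of Rayleigh quotients *)

Lemma quad_le_dot n (M : 'M[R]_n) :
  exists2 K, 0 < K & forall x, quad M x <= K * dot x x.
Proof.
pose K := \sum_i \sum_j `|M i j|.
have K0 : 0 <= K by apply: sumr_ge0 => i _; apply: sumr_ge0 => j _.
exists (K + 1); first by rewrite ltr_wpDl.
move=> x; rewrite mulrDl mul1r; apply: ler_wpDr; first exact: dot_ge0.
have sqr_le i : x i 0 ^+ 2 <= dot x x.
  rewrite dotE (bigD1 i) //= -expr2 lerDl; apply: sumr_ge0 => j _.
  by rewrite -expr2 sqr_ge0.
rewrite quadE dotE mulr_suml; apply: ler_sum => i _.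
rewrite mxE mulr_sumr mulr_suml; apply: ler_sum => j _.
rewrite mulrCA; apply: le_trans (ler_norm _) _; rewrite normrM.
apply: ler_wpM2l => //; rewrite ler_norml.
by have := sqr_le i; have := sqr_le j; nra.
Qed.

(** The hypothesis on [N], which the identity and [1 + A^T A] both satisfy,
    bounds the Rayleigh quotients below and makes their denominators
    positive. *)
Lemma psd_gen_lambda_min n (M N : 'M[R]_n) :
  (forall x, dot x x <= quad N x) -> psd (M - gen_lambda_min M N *: N).
Proof.
move=> N1 x; have [->|x0] := eqVneq x 0; first by rewrite quad0.
have Npos y : y != 0 -> 0 < quad N y.
  by move=> y0; apply: lt_le_trans (N1 y); rewrite dot_gt0.
rewrite quadD quadN quadZ subr_ge0 -ler_pdivlMr ?Npos //.
apply: ge_inf; last by exists x.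
have [K K0 leK] := quad_le_dot (- M).
exists (- K) => _ [y /= y0 <-]; rewrite ler_pdivlMr ?Npos //.
have := leK y; have := N1 y; rewrite quadN; nra.
Qed.

Lemma le_gen_lambda_min n (M N : 'M[R]_n) c (x0 : 'cV[R]_n) : x0 != 0 ->
  (forall x, dot x x <= quad N x) -> psd (M - c *: N) ->
  c <= gen_lambda_min M N.
Proof.
move=> x0n0 N1 Mc; apply: lb_le_inf.
  by exists (quad M x0 / quad N x0); exists x0.
move=> _ [y /= y0 <-]; rewrite ler_pdivlMr; last first.
  by apply: lt_le_trans (N1 y); rewrite dot_gt0.
by have := Mc y; rewrite quadD quadN quadZ subr_ge0.
Qed.

(** A semidefinite invertible matrix is positive definite with a quantitative
    bound: Cauchy-Schwarz between [x] and [B^-1 x] gives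
    [|x|^4 <= quad B x * quad B (B^-1 x)], where the last factor is
    [quad B^-1 x = O(|x|^2)]. *)
Lemma psd_unit n (B : 'M[R]_n) : B^T = B -> psd B -> B \in unitmx ->
  exists2 e, 0 < e & psd (B - e *: 1%:M).
Proof.
move=> Bsym B0 Bu; have [K K0 leK] := quad_le_dot (invmx B).
exists K^-1 => [|x]; first by rewrite invr_gt0.
rewrite quadD quadN quadZ quad_id subr_ge0.
have [->|x0] := eqVneq x 0; first by rewrite quad0 dotx0 mulr0.
have d0 : 0 < dot x x by rewrite dot_gt0.
have := psd_cauchy_schwarz x (invmx B *m x) Bsym B0.
have -> : quad B (invmx B *m x) = quad (invmx B) x.
  by rewrite !quadE mulKVmx // dotC.
rewrite mulKVmx // => CS; rewrite mulrC ler_pdivrMr //.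
have := leK x; have := B0 x; nra.
Qed.

(** The infimum [r] of the Rayleigh quotients is an eigenvalue: otherwise
    [M - r] would be semidefinite and invertible, hence [M - r - e] would still
    be semidefinite for some [e > 0], which contradicts the choice of [r]. *)
Lemma lambda_minE n (M : 'M[R]_n) (x0 : 'cV[R]_n) : M^T = M -> x0 != 0 ->
  lambda_min M = gen_lambda_min M 1%:M.
Proof.
move=> Msym x0n0; set r := gen_lambda_min M 1%:M.
have id1 (x : 'cV[R]_n) : dot x x <= quad 1%:M x by rewrite quad_id.
have Mr : psd (M - r *: 1%:M) := psd_gen_lambda_min M id1.
have r_lb : lbound [set a : R | eigenvalue M a] r.
  move=> a /eigenvalueP[v vM v0].
  have := Mr v^T; have vT0 : v^T != 0 by rewrite -trmx0 (inj_eq trmx_inj).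
  rewrite quadD quadN quadZ quad_id quadE -Msym -trmx_mul vM linearZ /=.
  by rewrite dotZr -mulrBl pmulr_lge0 ?dot_gt0 // subr_ge0.
have r_eig : eigenvalue M r.
  rewrite /eigenvalue kermx_eq0 row_free_unit -scalemx1; apply/negP => Bu.
  have Bsym : (M - r *: 1%:M)^T = M - r *: 1%:M.
    by rewrite linearB linearZ /= trmx1 Msym.
  have [e e0 Be] := psd_unit Bsym Mr Bu.
  have : r + e <= r.
    by apply: (le_gen_lambda_min x0n0 id1); rewrite scalerDl opprD addrA.
  by rewrite gerDl leNgt e0.
apply/le_anti/andP; split; first by apply: ge_inf => //; exists r.
by apply: lb_le_inf => //; exists r.
Qed.

Lemma psd_lambda_min n (M : 'M[R]_n) : M^T = M ->
  psd (M - lambda_min M *: 1%:M).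
Proof.
move=> Msym x; have [->|x0] := eqVneq x 0; first by rewrite quad0.
rewrite (lambda_minE Msym x0); apply: psd_gen_lambda_min => y.
by rewrite quad_id.
Qed.

Lemma le_lambda_min n (M : 'M[R]_n) c (x0 : 'cV[R]_n) : M^T = M -> x0 != 0 ->
  psd (M - c *: 1%:M) -> c <= lambda_min M.
Proof.
move=> Msym x0n0 Mc; rewrite (lambda_minE Msym x0n0).
by apply: (le_gen_lambda_min x0n0) => // y; rewrite quad_id.
Qed.

Lemma lambda_min_le0 n (M : 'M[R]_n) : M^T = M -> ~ psd M ->
  lambda_min M <= 0.
Proof.
move=> Msym Mn; rewrite leNgt; apply/negP => l0; apply: Mn => x.
have := psd_lambda_min Msym x; rewrite quadD quadN quadZ quad_id subr_ge0.
by apply: le_trans; rewrite mulr_ge0 ?dot_ge0 // ltW.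
Qed.

End Forms.

(** * Comparison of the objectives *)

Lemma le_optval (R : realType) (S T : Type) (F : set S) (G : set T) f g :
  (forall z, F z -> exists2 w, G w & g w <= f z :> R) ->
  (optval G g <= optval F f)%E.
Proof.
move=> FG; apply: le_ereal_inf_tmp => _ [z Fz <-].
have [w Gw le_gf] := FG z Fz; apply: le_trans (_ : (g w)%:E <= _)%E.
  by apply: ereal_inf_lbound; exists w.
by rewrite lee_fin.
Qed.

Section Relaxations.
Variables (R : realType) (n m p : nat).
Variables (Q : 'M[R]_n) (q : 'cV[R]_n).
Variables (A : 'M[R]_(m, n)) (b : 'cV[R]_m).
Variables (C : 'M[R]_(p, n)) (d : 'cV[R]_p).
Variables (l u : 'cV[R]_n).

(** The added term vanishes at the vertices of the box and is nonpositive in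
    it, so that this is an underestimate of the original objective when
    [alpha >= 0]. *)
Definition convexified alpha x : R :=
  quad Q x + dot q x + alpha * dot (x - l) (x - u).

Lemma box_dot x :
  dot (x - l) (x - u) = dot x x - dot (l + u) x + dot l u.
Proof. by rewrite !(dotDl, dotDr, dotNl, dotNr) (dotC x u); ring. Qed.

Lemma box_dot_le0 x : feasX A b C d l u x -> dot (x - l) (x - u) <= 0.
Proof.
case=> _ _ box; rewrite dotE -oppr_ge0 -sumrN; apply: sumr_ge0 => i _.
by have /andP[] := box i; rewrite !mxE; nra.
Qed.

Lemma mu_eigE alpha :
  mu_eig Q q A b C d l u alpha = optval (feasX A b C d l u) (convexified alpha).
Proof.
congr optval; apply/funext => x; rewrite /convexified box_dot.
by rewrite quadD quadZ quad_id dotDl dotNl dotZl; ring.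
Qed.

(** The penalty [alpha * |A x - b|^2] that distinguishes this problem vanishes on
    the feasible set. *)
Lemma mu_geigE alpha :
  mu_geig Q q A b C d l u alpha = optval (feasX A b C d l u) (convexified alpha).
Proof.
rewrite /mu_geig /optval; congr ereal_inf; apply: eq_imagel => x [Axb _ _].
congr EFin; rewrite /convexified box_dot !(quadD, quadZ) quad_id quad_gram.
rewrite dotDl dotNl dotZl dotDl dotZl Axb.
have -> : dot (A^T *m b) x = dot b b by rewrite -dot_mulmx Axb.
by ring.
Qed.

Lemma optval_convexified_le alpha beta : alpha <= beta ->
  (optval (feasX A b C d l u) (convexified beta) <=
   optval (feasX A b C d l u) (convexified alpha))%E.
Proof.
move=> ab; apply: le_optval => x Xx; exists x => //.
by rewrite lerD2l ler_wnM2r // box_dot_le0.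
Qed.

(** With [Y = X - x x^T], the difference of the two sides is
    [<Q + alpha I, Y> - alpha * (tr Y + (x - l)^T (x - u))], and the sum of the
    upper bounds on the [X i i] makes the bracket nonpositive. *)
Lemma convexified_le_sdp_obj alpha x X :
  feas_d A b C d l u (x, X) -> 0 <= alpha ->
  0 <= frob (Q + alpha *: 1%:M) (X - x *m x^T) ->
  convexified alpha x <= sdp_obj Q q (x, X).
Proof.
move=> [_ _ _ diag] a0; rewrite frobDl frobZl frob_id !frobDr frobNr frob_outer.
have trX : \tr X <= dot (l + u) x - dot l u.
  rewrite !dotE -sumrB; apply: ler_sum => i _; have [_ _] := diag i.
  by rewrite mxE; lra.
rewrite /convexified /sdp_obj /= box_dot linearB /=.
have -> : \tr (x *m x^T) = dot x x.
  by rewrite mxtrace_mulC /mxtrace big_ord1.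
nra.
Qed.

Lemma mx_tr_col (M : 'M[R]_n) (k : 'I_m) i :
  (A *m M^T) k i = \sum_j A k j * M i j.
Proof. by rewrite mxE; apply: eq_bigr => j _; rewrite mxE. Qed.

(** The constraints read [A X = b x^T], and [A x x^T = b x^T]. *)
Lemma dax_ker x X : A *m x = b -> X^T = X ->
  (forall (k : 'I_m) (i : 'I_n), \sum_j A k j * X i j = b k 0 * x i 0) <->
  A *m (X - x *m x^T) = 0.
Proof.
move=> Axb Xsym; rewrite mulmxBr mulmxA Axb; split => [AX|].
  apply/matrixP => k i; rewrite !mxE big_ord1 mxE -AX.
  apply/eqP; rewrite subr_eq0; apply/eqP/eq_bigr => j _.
  by rewrite -{1}Xsym mxE.
move=> /eqP; rewrite subr_eq0 => /eqP AX k i.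
by rewrite -mx_tr_col Xsym AX mxE big_ord1 mxE.
Qed.

(** The aggregated constraint says that the trace of [A Y A^T] vanishes.  Its
    diagonal entries are the values of the semidefinite form of [Y] at the rows
    of [A], so they all vanish, and then every row of [A] lies in the kernel of
    [Y]. *)
Lemma da_ker x X : A *m x = b -> X^T = X -> psd (X - x *m x^T) ->
  frob (A^T *m A) X - 2 * dot (A^T *m b) x + dot b b = 0 <->
  A *m (X - x *m x^T) = 0.
Proof.
move=> Axb Xsym; set Y := X - _ => Y0.
have Ysym : Y^T = Y by rewrite /Y linearB /= outer_sym Xsym.
have -> : frob (A^T *m A) X - 2 * dot (A^T *m b) x + dot b b
        = \tr (A *m Y *m A^T).
  have -> : \tr (A *m Y *m A^T) = frob (A^T *m A) Y.
    by rewrite frob_tr Ysym [LHS]mxtrace_mulC mulmxA.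
  rewrite frobDr frobNr frob_outer quad_gram -dot_mulmx Axb; ring.
split=> [trAYA|->]; last by rewrite mul0mx mxtrace0.
have AYAE i : (A *m Y *m A^T) i i = quad Y (row i A)^T.
  rewrite /quad trmxK -!row_mul !mxE; apply: eq_bigr => j _.
  by rewrite !mxE.
apply/row_matrixP => i; rewrite row_mul row0.
suff : Y *m (row i A)^T = 0.
  by move=> /(congr1 trmx); rewrite trmx_mul trmxK Ysym trmx0.
apply: psd_ker => //; rewrite -AYAE; apply/eqP.
have := trAYA; rewrite /mxtrace => /eqP.
rewrite psumr_eq0 => [/allP/(_ i)|j _]; last by rewrite AYAE.
by rewrite mem_index_enum; apply.
Qed.

Lemma feas_dax_da : feas_dax A b C d l u = feas_da A b C d l u.
Proof.
apply/seteqP; split => -[x X] [Fd H]; split => //;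
  have [[Axb _ _] Xsym Y0 _] := Fd.
- exact/da_ker/dax_ker.
- exact/dax_ker/da_ker.
Qed.

End Relaxations.

Theorem theorem2 (R : realType) (n m p k : nat)
  (Q : 'M[R]_n) (q : 'cV[R]_n)
  (A : 'M[R]_(m, n)) (b : 'cV[R]_m)
  (C : 'M[R]_(p, n)) (d : 'cV[R]_p)
  (l u : 'cV[R]_n) (Z : 'M[R]_(n, k))
  (alpha_e alpha_g alpha_z : R)
  (Qsym : Q^T = Q)
  (lu : forall i, l i 0 < u i 0)
  (Znull : orthonormal_nullspace_basis A Z)
  (indef : indefinite (Z^T *m Q *m Z))
  (alpha_eE : alpha_e = - lambda_min Q)
  (alpha_gE : alpha_g = - gen_lambda_min Q (1%:M + A^T *m A))
  (alpha_zE : alpha_z = - lambda_min (Z^T *m Q *m Z)) :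
  let mu_EIG := mu_eig Q q A b C d l u alpha_e in
  let mu_GEIG := mu_geig Q q A b C d l u alpha_g in
  let mu_EIGZ := mu_eig Q q A b C d l u alpha_z in
  let mu_SDP_d := mu_sdp_d Q q A b C d l u in
  let mu_SDP_dax := mu_sdp_dax Q q A b C d l u in
  let mu_SDP_da := mu_sdp_da Q q A b C d l u in
  (mu_SDP_d >= mu_EIG)%E /\
  [/\ mu_SDP_dax = mu_SDP_da, (mu_SDP_da >= mu_EIGZ)%E,
      (mu_EIGZ >= mu_GEIG)%E & (mu_GEIG >= mu_EIG)%E].
Proof.
have [ZtZ nullA] := Znull; have [notpsd _] := indef.
set M := Z^T *m Q *m Z in indef alpha_zE notpsd.
have Msym : M^T = M by rewrite /M !trmx_mul trmxK Qsym mulmxA.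
(* If [k] were zero, [M] would be semidefinite. *)
have [y0 y0n0] : exists y : 'cV[R]_k, y != 0.
  apply: contrapT => /forallNP all0; apply: notpsd => y.
  by have /negP/negPn/eqP -> := all0 y; rewrite quad0.
have quadM y : quad M y = quad Q (Z *m y) by rewrite quad_congr.
have dotZ (y : 'cV[R]_k) : dot (Z *m y) (Z *m y) = dot y y.
  by rewrite dot_mulmx mulmxA ZtZ mul1mx.
have AZ (y : 'cV[R]_k) : A *m (Z *m y) = 0 by rewrite (nullA _).2 //; exists y.
have Zy0n0 : Z *m y0 != 0 by rewrite -dot_gt0 dotZ dot_gt0.
have N1 (x : 'cV[R]_n) : dot x x <= quad (1%:M + A^T *m A) x.
  by rewrite quadD quad_id quad_gram lerDl dot_ge0.
have Qnotpsd : ~ psd Q by move=> Q0; apply/notpsd/psd_congr.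
have alpha_e0 : 0 <= alpha_e.
  by rewrite alpha_eE oppr_ge0 lambda_min_le0.
have alpha_z0 : 0 <= alpha_z.
  by rewrite alpha_zE oppr_ge0 lambda_min_le0.
have Qe : psd (Q + alpha_e *: 1%:M).
  by rewrite alpha_eE scaleNr; apply: psd_lambda_min.
have Mz : psd (M + alpha_z *: 1%:M).
  by rewrite alpha_zE scaleNr; apply: psd_lambda_min.
have Qg : psd (Q + alpha_g *: (1%:M + A^T *m A)).
  by rewrite alpha_gE scaleNr; apply: psd_gen_lambda_min.
have le_zg : alpha_z <= alpha_g.
  rewrite alpha_zE lerNl; apply: (le_lambda_min Msym y0n0) => y.
  rewrite quadD quadN quadZ quad_id mulNr opprK quadM -dotZ.
  have := Qg (Z *m y); rewrite quadD quadZ (quadD 1%:M) quad_id quad_gram AZ.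
  by rewrite dotx0 addr0.
have le_ge : alpha_g <= alpha_e.
  rewrite alpha_gE lerNl; apply: (le_gen_lambda_min Zy0n0 N1) => x.
  have := Qe x; rewrite quadD quadZ quad_id => Qex.
  by rewrite quadD quadN quadZ; have := N1 x; nra.
move=> mu_EIG mu_GEIG mu_EIGZ mu_SDP_d mu_SDP_dax mu_SDP_da.
rewrite /mu_EIG /mu_GEIG /mu_EIGZ !mu_eigE mu_geigE; split.
  apply: le_optval => -[x X] Fd; have [Xx Xsym Y0 _] := Fd.
  exists x => //; apply: convexified_le_sdp_obj Fd alpha_e0 _.
  by apply: frob_psd_ge0; rewrite // linearB /= outer_sym Xsym.
split; [|apply: le_optval => -[x X] [Fd aggr]| exact: optval_convexified_le..].
  by rewrite /mu_SDP_dax /mu_sdp_dax feas_dax_da.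
have [Xx Xsym Y0 _] := Fd; have [Axb _ _] := Xx.
exists x => //; apply: convexified_le_sdp_obj Fd alpha_z0 _.
have {aggr} AY := (da_ker Axb Xsym Y0).1 aggr; move: Y0 AY.
set Y := X - _ => Y0 AY.
have Ysym : Y^T = Y by rewrite /Y linearB /= outer_sym Xsym.
(* [Z Z^T] is the projection onto the nullspace of [A], which contains the
   columns of [Y] as [A Y = 0]. *)
have PY : Z *m Z^T *m Y = Y.
  apply/matrixP => i j; have [w Yj] : exists w, col j Y = Z *m w.
    by apply/nullA; rewrite colE mulmxA AY mul0mx.
  have : Z *m Z^T *m col j Y = col j Y.
    by rewrite Yj -mulmxA (mulmxA Z^T) ZtZ mul1mx.
  by move=> /colP/(_ i); rewrite colE mulmxA -!colE !mxE.
have YE : Y = Z *m (Z^T *m Y *m Z) *m Z^T.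
  have YP : Y *m (Z *m Z^T) = Y.
    by rewrite -{2}Ysym -{2}PY !trmx_mul trmxK Ysym.
  by rewrite !mulmxA PY -mulmxA YP.
rewrite YE frob_congr mulmxDr mulmxDl -scalemxAr -scalemxAl mulmx1 ZtZ.
apply: frob_psd_ge0 => //; last exact: psd_congr.
by rewrite !trmx_mul trmxK Ysym mulmxA.
Qed.
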